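(* Let $X$ be a real Banach space, let $\partial$ be a subdifferential on $X$ (in the sense defined in the context), and let $f:X\to\,]-\infty,+\infty]$ be proper and lower semicontinuous. Then, for every $x\in X$, $$(\partial f)^0(x)=\{\,x^*\in X^* : (f-x^* )(y+t(x-y))\le(f-x^* )(y),\ \forall y\in X,\ \forall t\in[0,1]\,\}.$$
   Context: $X$ is a real Banach space with closed unit ball $B_X$, $X^*$ is its topological dual and $\langle\cdot,\cdot\rangle$ is the duality pairing. All functions $f:X\to\,]-\infty,+\infty]$ considered are lower semicontinuous and proper, i.e. $\operatorname{dom} f:=\{x\in X : f(x)<\infty\}\neq\emptyset$. For $x^*\in X^*$, $f-x^*$ is the function $y\mapsto f(y)-\langle x^*,y\rangle$ with values in $]-\infty,+\infty]$; inequalities are understood in $]-\infty,+\infty]$, with $+\infty\le+\infty$. For $\bar{x}\in\operatorname{dom} f$, the subdifferential of convex analysis is $$\partial_{cx} f(\bar{x}):=\{x^*\in X^* : \langle x^*,y-\bar{x}\rangle+f(\bar{x})\le f(y),\ \forall y\in X\},$$ and the Clarke subdifferential is $$\partial_C f(\bar{x}):=\{x^*\in X^* : \langle x^*,d\rangle\le f^{\uparrow}(\bar{x};d),\ \forall d\in X\},$$ where $$f^{\uparrow}(\bar{x};d):=\sup_{\delta>0}\ \limsup_{t\searrow 0,\ x\to_f\bar{x}}\ \inf_{d'\in d+\delta B_X}\frac{f(x+td')-f(x)}{t}$$ and $x\to_f\bar{x}$ means $x\to\bar{x}$ and $f(x)\to f(\bar{x})$. All these sets are empty at points outside $\operatorname{dom}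 f$. A subdifferential on $X$ is an operator $\partial$ that associates to each proper lower semicontinuous function $f:X\to\,]-\infty,+\infty]$ a set-valued mapping $\partial f:X\rightrightarrows X^*$ such that: (i) $\partial_{cx} f(x)\subset\partial f(x)\subset\partial_C f(x)$ for every $x\in X$; (ii) $\partial(f-x^* )(x)=\partial f(x)-x^*$ for all $x\in X$ and $x^*\in X^*$; (iii) (Separation Principle) for any proper lower semicontinuous functions $f,\varphi$ on $X$ with $\varphi$ convex and Lipschitz near $\bar{x}\in\operatorname{dom} f\cap\operatorname{dom}\varphi$, if $f+\varphi$ admits a local minimum at $\bar{x}$, then $0\in\partial f(\bar{x})+\partial\varphi(\bar{x})$. A set-valued operator $T:X\rightrightarrows X^*$ is identified with its graph $\{(y,y^* ) : y^*\in T(y)\}\subset X\times X^*$. The monotone polar of $T$ is $$T^0:=\{(x,x^* )\in X\times X^* : \langle y^*-x^*,y-x\rangle\ge 0,\ \forall (y,y^* )\in T\},$$ also regarded as an operator $T^0:X\rightrightarrows X^*$, so that $T^0(x)=\{x^*\in X^* : (x,x^* )\in T^0\}$. *)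

(* Defs.v *)
From HB Require Import structures.
From mathcomp Require Import all_boot all_order all_algebra.
From mathcomp Require Import all_classical all_reals all_analysis.

Set Implicit Arguments.
Unset Strict Implicit.
Unset Printing Implicit Defensive.

Import Order.TTheory GRing.Theory Num.Theory.
Import numFieldNormedType.Exports.

Local Open Scope classical_set_scope.
Local Open Scope ring_scope.

Section continuous_functional.
Context {R : realType} {X : normedModType R}.

Definition continuous_functional : {pred X -> R^o} :=
  fun l => `[< linear l /\ continuous l >].

Lemma continuous_functional_submod : submod_closed continuous_functional.
Proof.
split.
  apply/asboolP; split; last by move=> x; exact: cvg_cst.
  by move=> a u v; change (0 = a *: 0 + 0 :> R^o); rewrite scaler0 addr0.
move=> a u v /asboolP[lu cu] /asboolP[lv cv]; apply/asboolP; split.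
  move=> b x y; rewrite !fctE lu lv !scalerDr -!addrA; congr (_ + _).
    by rewrite !scalerA mulrC.
  by rewrite addrCA.
by move=> x; apply: continuousD; [apply: continuousZr; exact: cu|exact: cv].
Qed.

HB.instance Definition _ :=
  GRing.isSubmodClosed.Build R (X -> R^o) continuous_functional
    continuous_functional_submod.

End continuous_functional.

(* The topological dual of X; as a subspace of X -> R^o it inherits the
   pointwise vector space operations. *)
Record dual (R : realType) (X : normedModType R) := Dual {
  dual_fun :> X -> R^o ;
  dual_funP : dual_fun \in continuous_functional }.
Arguments dual {R} X.

HB.instance Definition _ (R : realType) (X : normedModType R) :=
  [isSub for @dual_fun R X].
HB.instance Definition _ (R : realType) (X : normedModType R) :=
  [Choice of dual X by <:].
HB.instance Definition _ (R : realType) (X : normedModType R) :=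
  [SubChoice_isSubLmodule of dual X by <:].

Section subdifferentials.
Context {R : realType} {X : normedModType R}.
Implicit Types (f g : X -> \bar R) (xs ys : dual X).
Local Open Scope ereal_scope.

Definition dom f : set X := [set x | f x < +oo].

(* "Proper lower semicontinuous": functions with values in ]-oo, +oo] are
   encoded as functions into \bar R that never take the value -oo. *)
Definition proper_lsc f : Prop :=
  [/\ forall x, -oo < f x, dom f !=set0 & lower_semicontinuous f].

Definition tilt f xs : X -> \bar R := fun y => f y - (xs y)%:E.

Definition subdiff_cx f (x : X) : set (dual X) :=
  [set xs | dom f x /\ forall y, (xs (y - x)%R)%:E + f x <= f y].

(* The filter of the convergence u --> x together with f u --> f x. *)
Definition attentive_nbhs f (x : X) : set_system X :=
  filter_from [set UV : set X * set (\bar R) | nbhs x UV.1 /\ nbhs (f x) UV.2]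
    (fun UV => UV.1 `&` f @^-1` UV.2).

(* Where f u = +oo the quotient is the meaningless +oo - +oo (equal to -oo in
   \bar R); as f is finite on small sets of attentive_nbhs f x when f x is
   finite, these points do not contribute to the upper limit. *)
Definition clarke_derivative f (x d : X) : \bar R :=
  ereal_sup [set
    limf_esup
      (fun tu : R * X =>
         ereal_inf [set (f (tu.2 + tu.1 *: d')%R - f tu.2) * (tu.1^-1)%:E
                   | d' in closed_ball_ Num.norm d delta])
      (filter_prod 0^'+ (attentive_nbhs f x))
    | delta in [set delta : R | (0 < delta)%R]].

Definition subdiff_clarke f (x : X) : set (dual X) :=
  [set xs | dom f x /\ forall d, (xs d)%:E <= clarke_derivative f x d].

Definition econvex f : Prop :=
  forall (x y : X) (t : R), (0 <= t <= 1)%R ->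
    f (t *: x + (1 - t) *: y)%R <= t%:E * f x + (1 - t)%:E * f y.

Definition lipschitz_near f (x : X) : Prop :=
  exists2 U, nbhs x U &
    (forall y, U y -> f y \is a fin_num) /\
    [lipschitz (fine (f y) : R^o) | y in U].

Definition local_min f (x : X) : Prop := \forall y \near x, f x <= f y.

(* Nothing is required of D g when g is not proper lower semicontinuous. *)
Record is_subdifferential (D : (X -> \bar R) -> X -> set (dual X)) : Prop := {
  subdifferential_cx : forall f x, proper_lsc f -> subdiff_cx f x `<=` D f x;
  subdifferential_clarke : forall f x, proper_lsc f ->
    D f x `<=` subdiff_clarke f x;
  subdifferential_tilt : forall f xs x, proper_lsc f ->
    D (tilt f xs) x = [set (ys - xs)%R | ys in D f x];
  subdifferential_separation : forall f g x, proper_lsc f -> proper_lsc g ->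
    dom f x -> dom g x -> econvex g -> lipschitz_near g x ->
    local_min (f \+ g) x ->
    exists xs ys, [/\ D f x xs, D g x ys & 0%R = (xs + ys)%R] }.

Definition monotone_polar (T : X -> set (dual X)) : X -> set (dual X) :=
  fun x => [set xs | forall y ys, T y ys -> (0 <= (ys - xs)%R (y - x))%R].

End subdifferentials.

(* Main.v *)
Require Import Defs.
From mathcomp Require Import all_boot all_order all_algebra.
From mathcomp Require Import all_classical all_reals all_analysis.
From mathcomp Require Import ring lra.
Set Implicit Arguments.
Unset Strict Implicit.
Unset Printing Implicit Defensive.
Import Order.TTheory GRing.Theory Num.Theory.
Import numFieldNormedType.Exports.
Local Open Scope classical_set_scope.
Local Open Scope ring_scope.

(* Subtracting xs from f (tilting) reduces everything to xs = 0.

   If f does not increase along segments towards x, then for u near y the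
   direction x - u is admissible in the infimum defining the Clarke derivative
   of f at y along x - y, and its difference quotient at u is nonpositive; so
   this derivative is nonpositive, and it bounds every subgradient at y.

   Conversely, suppose f a < f c with c in ]a, b].  For small alpha > 0, the
   function g = f + alpha |. - b| attains its minimum over [a, c] at some
   x0 <> c.  Compactness of [a, c] makes x0 an approximate minimizer of
   g + k d(., [a, b]) on a ball for k large, and Ekeland's principle yields a
   true local minimizer u of f + phi, where
   phi = alpha |. - b| + k d(., [a, b]) + (alpha / 2) |. - u|.
   The separation principle gives xs in D f u with - xs a subgradient of phi at
   u.  Since phi b < phi u, xs is positive on b - u, so that (b, 0) is not in
   the monotone polar of D f. *)

(** * Adding a real number to an extended real *)

Section ereal_translation.
Context {R : realType}.
Implicit Types (x : \bar R) (r : R).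
Local Open Scope ereal_scope.

Lemma ltNy_addr_EFin x r : -oo < x -> -oo < x + r%:E.
Proof. by case: x => [q _| |]//; rewrite -EFinD ltNyr. Qed.

Lemma addr_EFin_lty x r : (x + r%:E < +oo) = (x < +oo).
Proof. by case: x => [q| |]//; rewrite -EFinD !ltry. Qed.

End ereal_translation.

(** * Upper bounds for the Clarke derivative, and the convex case *)

Section clarke.
Context {R : realType} {X : normedModType R}.
Implicit Types (f : X -> \bar R) (x y : X).
Local Open Scope ereal_scope.

(* Near x, the directions y - u are within delta of y - x, so the inner infimum
   may be tested on rays issued from u and aimed at y itself. *)
Lemma clarke_derivative_le f x y (c : R) (A : set X) :
  attentive_nbhs f x A ->
  (forall u t, A u -> (0 < t <= 1)%R ->
    (f (u + t *: (y - u))%R - f u) * (t^-1)%:E <= c%:E) ->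
  clarke_derivative f x (y - x)%R <= c%:E.
Proof.
move=> [[U V] /= [Ux Vx] UVA] fc; apply: ge_ereal_sup => _ [d /= d0 <-].
(* The upper limit is at most the supremum over any one set of the filter; here [t] is in ]0, 1] and
   [u] is in [A] within [d] of [x]. *)
apply: (@le_trans _ _ (ereal_sup ((fun tu : R * X =>
   ereal_inf [set (f (tu.2 + tu.1 *: d')%R - f tu.2) * (tu.1^-1)%:E
     | d' in closed_ball_ Num.norm (y - x)%R d]) @`
   [set tu | (0 < tu.1 <= 1)%R /\ (A tu.2 /\ (`|tu.2 - x| <= d)%R)]))).
  apply: ereal_inf_lbound; eexists; last reflexivity.
  exists ([set t | (0 < t <= 1)%R], [set u | A u /\ (`|u - x| <= d)%R]) => //=.
  split.
    near=> t; apply/andP; split; first by near: t; exact: nbhs_right_gt.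
    by near: t; apply: nbhs_right_le; exact: ltr01.
  exists (U `&` [set u | (`|u - x| <= d)%R], V) => /=.
    split=> //; apply: filterI => //.
    apply: (filterS _ (nbhsx_ballx x d d0)) => u.
    by rewrite -ball_normE /= distrC => /ltW.
  by move=> u [[Uu ux] Vu]; split=> //; exact: UVA.
apply: ge_ereal_sup => _ [[t u] /= [t01 [Au ud]] <-].
apply: (le_trans _ (fc u t Au t01)); apply: ereal_inf_lbound.
exists (y - u)%R => //=; rewrite /closed_ball_ /=.
by have -> : (y - x - (y - u) = u - x)%R by rewrite opprB addrC addrA subrK.
Unshelve. all: by end_near. Qed.

(** Convexity bounds the quotient at [u] towards [y] by [f y - f u], and [f u > f x - e] attentively
    near [x]. This turns the element given by the separation principle for the convex summand into a
    true convex subgradient. *)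
Lemma subdiff_clarke_convex f x :
  (forall u, -oo < f u) -> econvex f -> subdiff_clarke f x `<=` subdiff_cx f x.
Proof.
move=> fNy fcvx xs [fx xsP]; split=> // y.
have fxfin : f x \is a fin_num by rewrite fin_numElt fNy.
have [fy|] := ltP (f y) +oo; last by rewrite leye_eq => /eqP ->; rewrite leey.
have fyfin : f y \is a fin_num by rewrite fin_numElt fNy.
rewrite -(fineK fxfin) -(fineK fyfin) -EFinD lee_fin -lerBrDr.
apply/ler_addgt0Pr => e e0.
rewrite -lee_fin; apply: (le_trans (xsP _)).
apply: (@clarke_derivative_le _ _ _ _ [set u | (fine (f x) - e)%:E < f u]).
  exists (setT, [set a | (fine (f x) - e)%:E < a]) => /=.
    split; first exact: filterT.
    by apply: open_nbhs_nbhs; split; [exact: open_ereal_gt_ereal|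
       rewrite /= -{2}(fineK fxfin) lte_fin; lra].
  by move=> u [].
move=> u t /= fu /andP[t0 t1].
(* If [f u = +oo], the difference is [-oo] by convention and the bound is trivial. *)
have [fuy|] := ltP (f u) +oo; last first.
  by rewrite leye_eq => /eqP ->; rewrite addeNy gt0_mulNye ?leNye// lte_fin invr_gt0.
have fufin : f u \is a fin_num by rewrite fin_numElt fNy.
rewrite lee_pdivrMr//.
have := fcvx y u t; rewrite (ltW t0) t1 => /(_ isT).
have -> : (t *: y + (1 - t) *: u = u + t *: (y - u))%R.
  by rewrite scalerBr scalerBl scale1r addrCA.
rewrite leeBlDr//; move=> /le_trans; apply.
move: fu; rewrite -(fineK fufin) -(fineK fyfin) -!EFinM -!EFinD lee_fin lte_fin.
by move=> fu; nra.
Qed.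

Lemma clarke_derivative_radial f x y :
  (forall u t, (0 <= t <= 1)%R -> f (u + t *: (y - u))%R <= f u) ->
  clarke_derivative f x (y - x)%R <= 0.
Proof.
move=> fy; apply: (@clarke_derivative_le _ _ _ _ setT).
  by exists (setT, setT) => //; split; exact: filterT.
move=> u t _ /andP[t0 t1].
apply: mule_le0_ge0; last by rewrite lee_fin invr_ge0 ltW.
have := fy u t; rewrite (ltW t0) t1 => /(_ isT).
case: (f u) => [r| |] h.
- by rewrite leeBlDr// add0e.
- by rewrite addeNy.
- by move: h; rewrite leeNy_eq => /eqP ->; rewrite addNye leNye.
Qed.

End clarke.

(** * Convex Lipschitz functions: norms and distances to convex sets *)

Section convex_lipschitz.
Context {R : realType} {X : normedModType R}.
Implicit Types (p q : X -> R) (C : set X).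

(** A class stable under sums and nonnegative multiples, such that [EFin \o p] can serve as the
    convex summand in the separation principle. *)
Definition convex_lipschitz p :=
  (forall x y t, 0 <= t <= 1 ->
     p (t *: x + (1 - t) *: y) <= t * p x + (1 - t) * p y) /\
  exists2 k, 0 <= k & forall x y, `|p x - p y| <= k * `|x - y|.

Lemma convex_lipschitzD p q : convex_lipschitz p -> convex_lipschitz q ->
  convex_lipschitz (fun x => p x + q x).
Proof.
move=> [pc [k k0 pk]] [qc [l l0 ql]]; split.
  by move=> x y t t01; have := pc x y t t01; have := qc x y t t01; lra.
exists (k + l); first exact: addr_ge0.
move=> x y; rewrite opprD addrACA (le_trans (ler_normD _ _))//.
by rewrite mulrDl lerD.
Qed.

Lemma convex_lipschitzZ c p : 0 <= c -> convex_lipschitz p ->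
  convex_lipschitz (fun x => c * p x).
Proof.
move=> c0 [pc [k k0 pk]]; split.
  move=> x y t t01; rewrite (mulrCA t) (mulrCA (1 - t)) -mulrDr.
  by apply: ler_wpM2l => //; exact: pc.
exists (c * k); first exact: mulr_ge0.
by move=> x y; rewrite -mulrBr normrM ger0_norm// -mulrA ler_wpM2l.
Qed.

Lemma convex_lipschitz_norm b : convex_lipschitz (fun x => `|x - b|).
Proof.
split; last first.
  exists 1 => // x y; rewrite mul1r (le_trans (ler_dist_dist _ _))//.
  by rewrite opprB subrKA.
move=> x y t /andP[t0 t1].
have -> : t *: x + (1 - t) *: y - b = t *: (x - b) + (1 - t) *: (y - b).
  by rewrite !scalerBr addrACA -opprD -scalerDl (addrC t) subrK scale1r.
by rewrite (le_trans (ler_normD _ _))// !normrZ !ger0_norm// subr_ge0.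
Qed.

Definition dist C (z : X) : R := inf [set `|z - s| | s in C].

Lemma dist_has_inf C z : C !=set0 -> has_inf [set `|z - s| | s in C].
Proof.
by move=> [s Cs]; split; [exists `|z - s|, s|exists 0 => _ [u _ <-]].
Qed.

Lemma dist_le C z s : C s -> dist C z <= `|z - s|.
Proof.
move=> Cs; apply: ge_inf; last by exists s.
by have [] := @dist_has_inf C z (ex_intro _ s Cs).
Qed.

Lemma dist_ge0 C z : 0 <= dist C z.
Proof.
have [[s Cs]|C0] := pselect (C !=set0).
  by apply: lb_le_inf; [exists `|z - s|, s|move=> _ [u _ <-]].
(* The infimum of the empty set is 0 by convention. *)
rewrite /dist (_ : [set `|z - s| | s in C] = set0) ?inf0//.
by rewrite -subset0 => r [s Cs _]; case: C0; exists s.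
Qed.

Lemma dist_mem C s : C s -> dist C s = 0.
Proof.
move=> Cs; apply/eqP; rewrite eq_le dist_ge0 andbT.
by rewrite (le_trans (dist_le _ Cs))// subrr normr0.
Qed.

Lemma dist_adherent C z e : C !=set0 -> dist C z < e ->
  exists2 s, C s & `|z - s| < e.
Proof.
move=> C0; rewrite -subr_gt0 => e0.
have [_ [s Cs <-] h] := inf_adherent e0 (dist_has_inf z C0).
by exists s => //; move: h; rewrite -/(dist C z); lra.
Qed.

(** Almost nearest points [r] to [x] and [s] to [y] combine into a point of [C], which bounds the
    distance at the combination. *)
Lemma convex_lipschitz_dist C : C !=set0 ->
  (forall x y t, C x -> C y -> 0 <= t <= 1 -> C (t *: x + (1 - t) *: y)) ->
  convex_lipschitz (dist C).
Proof.
move=> C0 Cconv; split.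
  move=> x y t t01; apply/ler_addgt0Pr => e e0.
  have [r Cr xr] : exists2 r, C r & `|x - r| < dist C x + e.
    by apply: dist_adherent => //; rewrite ltrDl.
  have [s Cs ys] : exists2 s, C s & `|y - s| < dist C y + e.
    by apply: dist_adherent => //; rewrite ltrDl.
  apply: (le_trans (dist_le _ (Cconv _ _ _ Cr Cs t01))).
  rewrite opprD addrACA -!scalerBr (le_trans (ler_normD _ _))// !normrZ.
  have /andP[t0 t1] := t01; rewrite !ger0_norm ?subr_ge0//.
  by nra.
exists 1 => //.
have dd x y : dist C x - dist C y <= `|x - y|.
  rewrite lerBlDr; apply/ler_addgt0Pr => e e0.
  have [s Cs ys] : exists2 s, C s & `|y - s| < dist C y + e.
    by apply: dist_adherent => //; rewrite ltrDl.
  have := ler_normD (x - y) (y - s); rewrite subrKA.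
  by have := dist_le x Cs; lra.
by move=> x y; rewrite mul1r ler_norml dd andbT lerNl opprB (distrC x) dd.
Qed.

Lemma convex_lipschitz_continuous p :
  convex_lipschitz p -> continuous (p : X -> R^o).
Proof.
move=> [_ [k k0 pk]] x; apply/cvgrPdist_lt => e e0.
have d0 : 0 < e / (k + 1) by rewrite divr_gt0// ltr_wpDl.
apply: (filterS _ (nbhsx_ballx x _ d0)) => y; rewrite -ball_normE /= => xy.
apply: (le_lt_trans (pk x y)).
move: xy; rewrite ltr_pdivlMr ?ltr_wpDl// => xy.
by have := normr_ge0 (x - y); nra.
Qed.

Lemma convex_lipschitz_proper_lsc p : convex_lipschitz p -> proper_lsc (EFin \o p).
Proof.
move=> pp; split => /=.
- by move=> x; exact: ltNyr.
- by exists 0; rewrite /dom /= ltry.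
move=> x a /=; rewrite lte_fin -subr_gt0 => pa.
have /cvgrPdist_lt/(_ _ pa) px := convex_lipschitz_continuous pp (x := x).
eexists; first exact: px.
by move=> y /=; rewrite lte_fin ltr_norml => /andP[_]; lra.
Qed.

Lemma convex_lipschitz_econvex p : convex_lipschitz p -> econvex (EFin \o p).
Proof.
by move=> [pc _] x y t t01 /=; rewrite -!EFinM -EFinD lee_fin; exact: pc.
Qed.

Lemma convex_lipschitz_near p x :
  convex_lipschitz p -> lipschitz_near (EFin \o p) x.
Proof.
move=> [_ [k k0 pk]]; exists setT; first exact: filterT.
split=> //; apply: (@klipschitzW _ _ _ k).
  by apply: (@globally_properfilter _ _ (0, 0)).
by move=> [y z] _; exact: pk.
Qed.

End convex_lipschitz.

(** * Lower semicontinuity: sums, minima and uniformity on compact sets *)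

Section lower_semicontinuity.
Context {R : realType}.

Lemma lower_semicontinuous_addr (X : topologicalType) (f : X -> \bar R)
    (p : X -> R^o) :
  (forall x, -oo < f x)%E -> lower_semicontinuous f -> continuous p ->
  lower_semicontinuous (fun x => f x + (p x)%:E)%E.
Proof.
move=> fNy flsc pcont x a afp.
(* Half of the gap above [a] is spent on [f] and half on [p]; if [f x = +oo], [c] may be arbitrarily
   large. *)
have [c [e [e0 cf ace]]] : exists c e : R,
    [/\ 0 < e, (c%:E < f x)%E & a <= c + p x - e].
  move: (fNy x) afp; case: (f x) => [r| |]// _.
    rewrite -EFinD lte_fin => ar.
    exists (r - (r + p x - a) / 2), ((r + p x - a) / 2); rewrite lte_fin.
    by split; lra.
  by move=> _; exists (a - p x + 1), 1; rewrite ltry; split=> //; lra.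
have [V Vx Vf] := flsc x c cf.
have /cvgrPdist_lt/(_ e e0) px := pcont x.
exists (V `&` [set y | `|p x - p y| < e]); first exact: filterI.
move=> y [/Vf cfy /= pxy].
apply: (@le_lt_trans _ _ (c + p y)%:E).
  rewrite lee_fin; move: pxy; rewrite ltr_norml => /andP[]; lra.
by rewrite EFinD lteD2rE.
Qed.

(** Without a minimizer, the strict sublevel sets in [K] generate a proper filter. At a cluster
    point [p] some [f y < f p], yet [f] stays above [f y] near [p]. *)
Lemma lower_semicontinuous_min (X : topologicalType) (f : X -> \bar R)
    (K : set X) : compact K -> K !=set0 -> lower_semicontinuous f ->
  exists2 p, K p & forall y, K y -> (f p <= f y)%E.
Proof.
move=> Kc K0 flsc; apply: contrapT => nomin.
pose G := filter_from K (fun y => K `&` [set z | (f z < f y)%E]).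
have GF : ProperFilter G.
  apply: filter_from_proper.
    apply: filter_from_filter; first exact: K0.
    move=> i j Ki Kj; have [ij|ji] := leP (f i) (f j).
      by exists i => // z [Kz zi]; split; split=> //=; exact: lt_le_trans ij.
    by exists j => // z [Kz zj]; split; split=> //=; exact: lt_trans ji.
  move=> y Ky; apply: contrapT => ymin; apply: nomin; exists y => // z Kz.
  by rewrite leNgt; apply/negP => zy; apply: ymin; exists z.
have GK : G K by case: K0 => y Ky; exists y => // z [].
have [p [Kp pG]] := Kc G GF GK.
apply: nomin; exists p => // y Ky; rewrite leNgt; apply/negP => yp.
have [a /andP[za ap]] : exists a : R, (f y <= a%:E < f p)%E.
  case: (f y) (f p) yp => [r| |] [q| |]//= yp.
  - by exists r; rewrite lexx.
  - by exists r; rewrite lexx.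
  - by exists (q - 1); rewrite leNye lte_fin /=; lra.
  - by exists 0; rewrite leNye ltry.
have [V Vp Vf] := flsc p a ap.
have [w [[Kw wy] /Vf]] := pG _ V (ex_intro2 _ _ y Ky (@subset_refl _ _)) Vp.
by rewrite ltNge (le_trans _ za)// ltW.
Qed.

Lemma lower_semicontinuous_compact_gt (X : normedModType R) (f : X -> \bar R)
    (K : set X) (m : R) : compact K -> lower_semicontinuous f ->
  (forall s, K s -> (m%:E < f s)%E) ->
  exists2 d : R, 0 < d & forall s z, K s -> `|z - s| < d -> (m%:E < f z)%E.
Proof.
move=> /compact_near_coveringP Kc flsc mf.
have := Kc R 0^'+ (fun d s => forall z, `|z - s| < d -> (m%:E < f z)%E) _.
case.
  move=> s /mf/flsc[V /nbhs_ballP[r /= r0 rV] Vf].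
  exists (ball s (r / 2), [set d : R | d < r / 2]) => /=.
    split; first by apply: nbhsx_ballx; rewrite divr_gt0.
    by apply: nbhs_right_lt; rewrite divr_gt0.
  move=> [s' d] /= [ss' dr] z zs'; apply: Vf; apply: rV.
  move: ss'; rewrite -!ball_normE /= => ss'.
  rewrite -(subrKA s') (le_lt_trans (ler_normD _ _))//.
  by rewrite [X in _ + X]distrC; lra.
move=> d /= d0 dK; exists (d / 2); first by rewrite divr_gt0.
move=> s z Ks; apply: dK => //=; last by rewrite divr_gt0.
by rewrite sub0r normrN gtr0_norm ?divr_gt0// ltr_pdivrMr// mulr2n mulrDr mulr1 ltrDl.
Qed.

End lower_semicontinuity.

(** * Ekeland's variational principle *)

(* Zorn's lemma for the Bishop-Phelps order, where v is above u when
   f v + e |v - u| <= f u; as f is bounded below, a chain is Cauchy, and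
   its limit is an upper bound. *)
Lemma ekeland (R : realType) (X : completeNormedModType R) (f : X -> \bar R)
    (C : set X) (x0 : X) (m e : R) :
  (forall x, -oo < f x)%E -> lower_semicontinuous f -> closed C ->
  (forall x, C x -> m%:E <= f x)%E -> C x0 -> (f x0 < +oo)%E -> 0 < e ->
  exists u, [/\ C u, (f u + (e * `|u - x0|)%:E <= f x0)%E &
    forall z, C z -> (f u <= f z + (e * `|z - u|)%:E)%E].
Proof.
move=> fNy flsc Ccl mf Cx0 fx0 e0.
pose S u := [set z | (f z + (e * `|z - u|)%:E <= f u)%E].
have Scl u : closed (S u).
  have glsc : lower_semicontinuous (fun z => f z + (e * `|z - u|)%:E)%E.
    apply: lower_semicontinuous_addr => //; apply: convex_lipschitz_continuous.
    by apply: convex_lipschitzZ (convex_lipschitz_norm u); exact: ltW.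
  rewrite /S; case: (f u) (fNy u) => [r| |]// _.
    have /lower_semicontinuousP/(_ r)/open_closedC := glsc.
    by congr closed; apply/seteqP; split=> z /=; rewrite leNgt => /negP.
  rewrite (_ : mkset _ = setT); first exact: closedT.
  by apply/seteqP; split=> z //= _; rewrite leey.
have Sxx u : S u u by rewrite /S /= subrr normr0 mulr0 adde0.
have Strans u v w : S u v -> S v w -> S u w.
  rewrite /S /= => uv vw; apply: le_trans uv.
  apply: (@le_trans _ _ (f w + (e * `|w - v|)%:E + (e * `|v - u|)%:E)%E).
    rewrite -addeA leeD2l// lee_fin -mulrDr ler_pM2l//.
    by rewrite -(subrKA v) ler_normD.
  by rewrite leeD2r.
have Sfin u : S x0 u -> f u \is a fin_num.
  rewrite /S /= => h; rewrite fin_numElt fNy/=.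
  have := le_lt_trans h fx0; case: (f u) (fNy u) => //= r _; exact: ltry.
(* Staying above [x0] keeps all values finite and gives the second conclusion. *)
pose T := {z | C z /\ S x0 z}.
pose Rel (u v : T) := `[< S (sval u) (sval v) >].
have [||A Atot|u umax] := @ZL_preorder T (exist _ x0 (conj Cx0 (Sxx x0))) Rel.
- by move=> u; apply/asboolP; exact: Sxx.
- by move=> u v w /asboolP vu /asboolP uw; apply/asboolP; exact: Strans vu uw.
- have [[a Aa]|A0] := pselect (A !=set0); last first.
    exists (exist _ x0 (conj Cx0 (Sxx x0))) => s As; exfalso; apply: A0.
    by exists s.
  (* [G] is the filter of tails of the chain [A]. *)
  pose G := filter_from A
    (fun u => [set z | exists2 v, A v & sval v = z /\ S (sval u) z]).
  have GF : ProperFilter G.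
    apply: filter_from_proper; last first.
      by move=> u Au; exists (sval u), u => //; split=> //; exact: Sxx.
    apply: filter_from_filter; first by exists a.
    move=> u v Au Av; have [/asboolP uv|/asboolP vu] := Atot _ _ Au Av.
      exists v => // z [w Aw [wz vz]]; split; exists w => //.
      by split=> //; exact: Strans vz.
    exists u => // z [w Aw [wz uz]]; split; exists w => //.
    by split=> //; exact: Strans uz.
  pose V := [set fine (f (sval u)) | u in A].
  have VP (u : T) : (fine (f (sval u)))%:E = f (sval u).
    by rewrite fineK//; apply: Sfin; case: (svalP u).
  have Vinf : has_inf V.
    split; first by exists (fine (f (sval a))), a.
    exists m => _ [u Au <-]; rewrite -lee_fin VP; apply: mf.
    by case: (svalP u).
  have Gc : cauchy G.
    apply: cauchy_exP => r r0.
    (* With [f u] within [e * r] of the infimum, each [v] of the chain above [u] has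
       [e * |v - u| <= f u - f v < e * r]. *)
    have [_ [u Au <-] ui] := inf_adherent (mulr_gt0 e0 r0) Vinf.
    exists (sval u), u => // _ [v Av [<- Suv]].
    rewrite -ball_normE /= distrC -(ltr_pM2l e0).
    have : inf V <= fine (f (sval v)) by apply: ge_inf; [case: Vinf|exists v].
    move: Suv; rewrite /S /= -(VP u) -(VP v) -EFinD lee_fin; lra.
  have /cvg_ex[p Gp] := @cauchy_cvg X G GF Gc.
  have pin (D : set X) : closed D -> G D -> D p.
    by move=> Dcl GD; exact: (@closed_cvg _ _ G _ id D Dcl GD p Gp).
  have pS u : A u -> S (sval u) p.
    by move=> Au; apply: pin => //; exists u => // z [v _ []].
  have pT : C p /\ S x0 p.
    split.
      by apply: pin => //; exists a => // _ [v _ [<- _]]; case: (svalP v).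
    by apply: Strans (pS a Aa); case: (svalP a).
  exists (exist _ p pT) => s As; apply/asboolP; exact: pS.
exists (sval u); have [Cu Su] := svalP u; split=> // z Cz.
rewrite leNgt; apply/negP => fz.
have zu : S (sval u) z by exact: ltW.
have zT : C z /\ S x0 z by split=> //; exact: Strans zu.
(* Maximality in a preorder only puts [u] above [z] in turn; then [f u <= f z], which contradicts
   [fz]. *)
have /asboolP/= uz : Rel (exist _ z zT) u by apply: umax; apply/asboolP.
move: fz; rewrite ltNge => /negP; apply.
apply: (@le_trans _ _ (f z)); last by rewrite leeDl// lee_fin mulr_ge0// ltW.
by apply: le_trans uz; rewrite leeDl// lee_fin mulr_ge0// ltW.
Qed.

(** * A mean value property of subdifferentials *)

Lemma subdifferential_mean_value (R : realType) (X : completeNormedModType R)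
    (D : (X -> \bar R) -> X -> set (dual X)) (f : X -> \bar R) (a b : X)
    (T : R) :
  is_subdifferential D -> proper_lsc f -> 0 <= T <= 1 ->
  (f a < f (a + T *: (b - a))%R)%E ->
  exists u xs, D f u xs /\ 0 < xs (b - u).
Proof.
move=> Dsub fplsc /andP[T0 T1] fac; have [fNy _ flsc] := fplsc.
pose pt t := a + t *: (b - a).
have pt0 : pt 0 = a by rewrite /pt scale0r addr0.
have pt1 : pt 1 = b by rewrite /pt scale1r addrC subrK.
have ptB s t : `|pt s - pt t| = `|s - t| * `|b - a|.
  by rewrite /pt opprD addrACA subrr add0r -scalerBl normrZ.
have ptcvx s t l : l *: pt s + (1 - l) *: pt t = pt (l * s + (1 - l) * t).
  rewrite /pt; move: (b - a) => v; rewrite !scalerDr !scalerA addrACA -!scalerDl.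
  by rewrite [l + _]addrC subrK scale1r.
have ptcont : continuous pt.
  move=> t; apply: cvgD; first exact: cvg_cst.
  apply: cvgZr_tmp; exact: cvg_id.
have N0 : 0 < `|b - a|.
  rewrite normr_gt0; apply: contraTneq fac => ->.
  by rewrite scaler0 addr0 ltxx.
have fafin : f a \is a fin_num by rewrite fin_numElt fNy (lt_le_trans fac)// leey.
(* [al * |a - b|] is half of the gap between [f a] and [f (pt T)] when the latter is finite, so
   [pt T] cannot minimize [g] over [K]. *)
have [al [al0 fal]] : exists al : R,
    0 < al /\ (f a + (al * `|a - b|)%:E < f (pt T))%E.
  move: fac; rewrite -/(pt T) -(fineK fafin) distrC.
  case: (f (pt T)) => [c| |]// => [|_]; last by exists 1; rewrite -EFinD ltry.
  rewrite lte_fin => ac; exists ((c - fine (f a)) / (2 * `|b - a|)).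
  rewrite divr_gt0 ?subr_gt0 ?mulr_gt0// -EFinD lte_fin; split=> //.
  by rewrite invfM mulrA mulfVK ?gt_eqF//; lra.
pose g z := (f z + (al * `|z - b|)%:E)%E.
have gcl : convex_lipschitz (fun z => al * `|z - b|).
  by apply: convex_lipschitzZ (convex_lipschitz_norm b); exact: ltW.
have glsc : lower_semicontinuous g.
  by apply: lower_semicontinuous_addr => //; exact: convex_lipschitz_continuous.
pose K := pt @` `[0, T].
have Kc : compact K.
  apply: continuous_compact; last exact: segment_compact.
  exact: continuous_subspaceT.
have Ka : K a by exists 0 => //=; rewrite in_itv /= lexx.
have [_ [t0 t0T <-] gmin] := lower_semicontinuous_min Kc (ex_intro _ a Ka) glsc.
move: t0T; rewrite /= in_itv /= => /andP[t00 t0T].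
set x0 := pt t0 in gmin.
have gx0a : (g x0 <= g a)%E by exact: gmin.
have {}t0T : t0 < T.
  rewrite lt_neqAle t0T andbT; apply: contraTneq (le_lt_trans gx0a fal).
  move=> t0T'; rewrite /x0 t0T' -leNgt /g leeDl// lee_fin mulr_ge0//.
  exact: ltW.
have gx0fin : g x0 \is a fin_num.
  rewrite fin_numElt (le_lt_trans gx0a) ?andbT; last first.
    by rewrite addr_EFin_lty (lt_le_trans fac) ?leey.
  by rewrite ltNy_addr_EFin.
set m := fine (g x0); have mE : g x0 = m%:E by rewrite fineK.
(* [rho] is the distance from [x0] to [pt T]: any [pt t] closer to [x0] has [t < T]. *)
pose rho := (T - t0) * `|b - a|.
have rho0 : 0 < rho by rewrite mulr_gt0// subr_gt0.
have /glsc[V /nbhs_ballP[r1 /= r10 r1V] Vg] : ((m - 1)%:E < g x0)%E.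
  by rewrite mE lte_fin; lra.
pose r := Num.min rho r1 / 2.
have r0 : 0 < r by rewrite divr_gt0// lt_min rho0.
have rrho : r < rho.
  by rewrite ltr_pdivrMr// (@le_lt_trans _ _ rho) ?ge_min ?lexx//; lra.
have rr1 : r < r1.
  by rewrite ltr_pdivrMr// (@le_lt_trans _ _ r1) ?ge_min ?lexx ?orbT//; lra.
(* An [eta]-minimizer and Ekeland slope [al / 2] give [|u - x0| <= 2 * eta / al = r / 2], so [u] is
   interior to the ball [C]. *)
pose eta := al * r / 4.
have eta0 : 0 < eta by rewrite /eta divr_gt0// mulr_gt0.
have [||del del0 delg] := @lower_semicontinuous_compact_gt _ _ g K (m - eta) Kc.
- exact: glsc.
- move=> s /gmin; apply: lt_le_trans; rewrite mE lte_fin; lra.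
(* A point of [L] within [de] of some [z] in [C] is within [rho] of [x0], hence before [pt T], and
   within [del] of [z], so that [delg] applies. *)
pose de := Num.min del (rho - r).
have de0 : 0 < de by rewrite lt_min del0 subr_gt0.
(* The penalty is the distance to the whole segment rather than to [K], so that it also vanishes at
   [b]. *)
pose L := pt @` `[0, 1].
have Lpt t : 0 <= t <= 1 -> L (pt t) by exists t => //=; rewrite in_itv.
have dcl : convex_lipschitz (fun z => al * `|z - b| + de^-1 * dist L z).
  apply: convex_lipschitzD => //; apply: convex_lipschitzZ.
    by rewrite invr_ge0 ltW.
  apply: convex_lipschitz_dist.
    by exists a; rewrite -pt0; apply: Lpt; rewrite lexx ler01.
  move=> _ _ l [s /= + <-] [t /= + <-] /andP[l0 l1]; rewrite !in_itv /=.
  move=> /andP[s0 s1] /andP[t00' t1]; rewrite ptcvx; apply: Lpt.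
  by apply/andP; split; nra.
pose F z := (f z + (al * `|z - b| + de^-1 * dist L z)%:E)%E.
have FE z : F z = (g z + (de^-1 * dist L z)%:E)%E by rewrite /F /g EFinD addeA.
have Lx0 : L x0 by apply: Lpt; rewrite t00/=; lra.
have Fx0 : F x0 = m%:E by rewrite FE dist_mem// mulr0 adde0.
have Flsc : lower_semicontinuous F.
  by apply: lower_semicontinuous_addr => //; exact: convex_lipschitz_continuous.
have FNy z : (-oo < F z)%E.
  exact: ltNy_addr_EFin.
pose C := closed_ball_ Num.norm x0 r.
have FC z : C z -> ((m - eta)%:E <= F z)%E.
  rewrite /C /closed_ball_ /= => x0z; rewrite FE.
  have kd0 : 0 <= de^-1 * dist L z by rewrite mulr_ge0 ?dist_ge0// invr_ge0 ltW.
  (* Near [L] the bound on [g] around [K] suffices; away from [L] the penalty is at least 1 and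
     makes up for [g z > m - 1]. *)
  have [ddz|ddz] := ltP (dist L z) de.
    have [_ [t /= t01 <-] zt] := dist_adherent (ex_intro _ x0 Lx0) ddz.
    apply: (@le_trans _ _ (g z)); last by rewrite leeDl.
    apply/ltW/(delg (pt t)); last by rewrite (lt_le_trans zt)// ge_min lexx.
    exists t => //=; move: t01; rewrite !in_itv /= => /andP[-> _] /=.
    have : `|pt t0 - pt t| < rho.
      rewrite -(subrKA z) (le_lt_trans (ler_normD _ _))//.
      have : `|z - pt t| < rho - r.
        by rewrite (lt_le_trans zt)// ge_min lexx orbT.
      by move: x0z; rewrite /x0; lra.
    rewrite ptB ltr_pM2r// distrC => /ltr_normlP[]; lra.
  have /Vg gz : V z by apply: r1V; rewrite -ball_normE /= (le_lt_trans x0z).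
  apply: (@le_trans _ _ ((m - 1)%:E + 1%:E)%E).
    by rewrite -EFinD lee_fin; lra.
  apply: leeD; first exact: ltW.
  by rewrite lee_fin mulrC ler_pdivlMr// mul1r.
have [||||u [Cu Fu Fumin]] :=
  @ekeland _ _ F C x0 (m - eta) (al / 2) FNy Flsc _ FC.
- exact: closed_closed_ball_.
- by rewrite /C /closed_ball_ /= subrr normr0 ltW.
- by rewrite Fx0 ltry.
- by rewrite divr_gt0.
have ux0 : `|u - x0| <= r / 2.
  have := le_trans (leeD2r _ (FC u Cu)) Fu; rewrite Fx0 -EFinD lee_fin /eta.
  by move=> h; rewrite -(ler_pM2l al0); lra.
have fu : dom f u.
  rewrite /dom /= -(addr_EFin_lty _ (al * `|u - b| + de^-1 * dist L u)).
  rewrite -(addr_EFin_lty _ (al / 2 * `|u - x0|)).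
  by rewrite (le_lt_trans Fu)// Fx0 ltry.
(* [b] is at least [rho] away from [x0], and [u] at most [r / 2 < rho]. *)
have ub : 0 < `|u - b|.
  have : `|pt t0 - pt 1| <= `|u - x0| + `|u - b|.
    by rewrite pt1 -(subrKA u) (le_trans (ler_normD _ _))// distrC.
  rewrite ptB ler0_norm; last by lra.
  have : rho <= - (t0 - 1) * `|b - a| by rewrite /rho ler_pM2r//; lra.
  by move: ux0 rrho r0; lra.
pose p z := al * `|z - b| + de^-1 * dist L z + al / 2 * `|z - u|.
have pcl : convex_lipschitz p.
  apply: convex_lipschitzD => //.
  apply: convex_lipschitzZ (convex_lipschitz_norm u).
  by rewrite divr_ge0// ltW.
have pplsc := convex_lipschitz_proper_lsc pcl.
have [||||xs [ys [fxs pys xys]]] :=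
  subdifferential_separation Dsub fplsc pplsc fu.
- by rewrite /dom /= ltry.
- exact: convex_lipschitz_econvex.
- exact: convex_lipschitz_near.
- have r20 : 0 < r / 2 by rewrite divr_gt0.
  apply: (filterS _ (nbhsx_ballx u _ r20)) => z; rewrite -ball_normE /= => uz.
  rewrite /p subrr normr0 mulr0 addr0 (EFinD _ (_ * `|z - u|)) addeA.
  apply: Fumin; rewrite /C /closed_ball_ /= -(subrKA u).
  by rewrite (le_trans (ler_normD _ _))// distrC; lra.
exists u, xs; split=> //.
(* As the Ekeland slope is only half of [al], [ys (b - u) <= p b - p u <= - (al / 2) * |u - b| <
   0]. *)
have pNy z : (-oo < (EFin \o p) z)%E by exact: ltNyr.
have [_ /(_ b)] := subdiff_clarke_convex pNy (convex_lipschitz_econvex pcl)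
  (subdifferential_clarke Dsub pplsc pys).
rewrite /= -EFinD lee_fin /p !subrr !normr0 !mulr0 addr0 add0r.
rewrite (dist_mem (s := b)); last by rewrite -pt1; apply: Lpt; rewrite ler01 lexx.
have : 0 <= de^-1 * dist L u by rewrite mulr_ge0 ?dist_ge0// invr_ge0 ltW.
have : xs (b - u) + ys (b - u) = 0.
  by have := congr1 (fun zs : dual X => zs (b - u)) xys.
rewrite (distrC b) mulr0 add0r.
by have := mulr_gt0 al0 ub; lra.
Qed.

(** * Tilting by a functional, and the description of the monotone polar *)

Section tilt.
Context {R : realType} {X : normedModType R}.
Implicit Types (f : X -> \bar R) (xs : dual X).

Lemma dual_linear_continuous xs : linear xs /\ continuous xs.
Proof. exact/asboolP/dual_funP. Qed.

Lemma dualN xs z : xs (- z) = - xs z.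
Proof.
have [xsl _] := dual_linear_continuous xs.
have xs0 : xs 0 = 0.
  by have := xsl (-1) 0 0; rewrite scaler0 addr0 scaleN1r addNr.
by rewrite -[- z]addr0 -scaleN1r xsl xs0 addr0 scaleN1r.
Qed.

Lemma proper_lsc_tilt f xs : proper_lsc f -> proper_lsc (tilt f xs).
Proof.
move=> [fNy [z fz] flsc]; split.
- by move=> y; rewrite /tilt -EFinN ltNy_addr_EFin.
- by exists z; rewrite /dom /= /tilt -EFinN addr_EFin_lty.
apply: (@lower_semicontinuous_addr _ _ f (fun y => - xs y)) => // y.
by apply: continuousN; apply: (dual_linear_continuous xs).2.
Qed.

End tilt.

Theorem theorem3p1 (R : realType) (X : completeNormedModType R)
    (D : (X -> \bar R) -> X -> set (dual X)) (f : X -> \bar R) :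
  is_subdifferential D -> proper_lsc f ->
  forall x : X,
    monotone_polar (D f) x =
    [set xs : dual X | forall (y : X) (t : R), 0 <= t <= 1 ->
      (tilt f xs (y + t *: (x - y))%R <= tilt f xs y)%E].
Proof.
move=> Dsub fplsc x; apply/seteqP; split=> xs /= xsP.
  move=> y t t01; rewrite leNgt; apply/negP => fyx.
  have [u [zs]] := subdifferential_mean_value Dsub
    (proper_lsc_tilt xs fplsc) t01 fyx.
  (* [ys - xs] is positive on [x - u], against the polarity inequality at [(u, ys)]. *)
  rewrite (subdifferential_tilt Dsub)// => -[[ys ysD <-]].
  have := xsP u ys ysD; rewrite -(opprB x u) dualN.
  by lra.
move=> y ys ysD.
have /(subdifferential_clarke Dsub (proper_lsc_tilt xs fplsc)) [_ /(_ (x - y))] :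
    D (tilt f xs) y (ys - xs).
  by rewrite (subdifferential_tilt Dsub)//; exists ys.
move=> /le_trans/(_ (clarke_derivative_radial y xsP)).
by rewrite lee_fin -(opprB y x) dualN oppr_le0.
Qed.
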